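(* Let $p$ be a prime, let $r,m\ge 1$ be integers, and let $\mathcal R=GR(p^r,m)$. For every basis $\{\beta_1,\ldots,\beta_m\}$ of $\mathcal R$ over $\mathbb Z_{p^r}$ there exists a unique basis $\{\alpha_1,\ldots,\alpha_m\}$ of $\mathcal R$ over $\mathbb Z_{p^r}$ which is dual to it, i.e. such that $T(\beta_i\alpha_j)=\delta_{ij}$ for all $1\le i,j\le m$.
   Context: $\mathbb Z_{p^r}$ is the ring of integers modulo $p^r$. $GR(p^r,m)$ denotes the Galois ring of characteristic $p^r$ and cardinality $p^{rm}$, i.e. (up to isomorphism) $\mathbb Z_{p^r}[x]/(h(x))$ where $h$ is a monic polynomial of degree $m$ over $\mathbb Z_{p^r}$ whose reduction mod $p$ is irreducible over $\mathbb F_p$. It is a free $\mathbb Z_{p^r}$-module of rank $m$; ''basis'' means a (indexed) free basis over $\mathbb Z_{p^r}$. There is an element $\xi\in\mathcal R$ of multiplicative order $p^m-1$; put $\mathcal T=\{0,1,\xi,\ldots,\xi^{p^m-2}\}$. Every $z\in\mathcal R$ is uniquely $z=z_0+pz_1+\cdots+p^{r-1}z_{r-1}$ with $z_i\in\mathcal T$, and the generalized Frobenius map is $z^f=z_0^p+pz_1^p+\cdots+p^{r-1}z_{r-1}^p$; it is a ring automorphism of $\mathcal R$ of order $m$, fixing $\mathbb Z_{p^r}$ elementwise and generating the Galois group of $\mathcal R$ over $\mathbb Z_{p^r}$. The generalized trace $T:\mathcal R\to\mathbb Z_{p^r}$ is $T(z)=z+z^f+z^{f^2}+\cdots+z^{f^{m-1}}$.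 $\delta_{ij}$ is the Kronecker delta. Two bases $\{\alpha_i\}$, $\{\beta_j\}$ are dual if $T(\beta_i\alpha_j)=\delta_{ij}$ for all $i,j$. *)

(* Defs.v *)
From HB Require Import structures.
From mathcomp Require Import all_boot all_order all_algebra.
From mathcomp Require Import qpoly.

Set Implicit Arguments.
Unset Strict Implicit.
Unset Printing Implicit Defensive.

Import GRing.Theory.
Local Open Scope ring_scope.

(* Bases of a module over a ring: vector.v only treats base fields. *)
Definition is_basis (A : nzRingType) (V : lmodType A) (m : nat)
    (b : {ffun 'I_m -> V}) : Prop :=
  (forall c : {ffun 'I_m -> A}, \sum_(i < m) c i *: b i = 0 -> c = 0) /\
  (forall z : V, exists c : {ffun 'I_m -> A}, z = \sum_(i < m) c i *: b i).

Definition red_mod (p n : nat) (h : {poly 'Z_n}) : {poly 'F_p} :=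
  map_poly (fun c : 'Z_n => (c : nat)%:R) h.

(* When [galois_poly p r m h] holds, [{poly %/ h}] is the ring Z_{p^r}[x]/(h),
   i.e. the Galois ring GR(p^r, m); every Galois ring has this form. *)
Definition galois_poly (p r m : nat) (h : {poly 'Z_(p ^ r)}) : Prop :=
  [/\ h \is monic, size h = m.+1 & irreducible_poly (red_mod p h)].

Arguments galois_poly p r m h : clear implicits.

(* qpoly.v has the finite structure on the underlying {poly_n A} only. *)
HB.instance Definition _ (A : finComNzRingType) (h : {poly A}) :=
  Finite.on {poly %/ h}.

Section Frobenius.

Variables (p r m : nat) (R : finComNzRingType).

(* An element of multiplicative order p^m - 1. The defaults of the picks here
   and in [teich_digits] are never reached in GR(p^r, m). *)
Definition teich_gen : R :=
  odflt 0 [pick x : R | ((p ^ m).-1).-primitive_root x].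

Definition teich_set : {set R} :=
  0 |: [set teich_gen ^+ val k | k : 'I_(p ^ m).-1].

(* The digits z_i in T of z = z_0 + p z_1 + ... + p^(r-1) z_(r-1). *)
Definition teich_digits (z : R) : {ffun 'I_r -> R} :=
  odflt [ffun=> 0]
    [pick t : {ffun 'I_r -> R} |
      [forall i, t i \in teich_set] && (z == \sum_(i < r) p%:R ^+ i * t i)].

Definition gfrob (z : R) : R :=
  \sum_(i < r) p%:R ^+ i * teich_digits z i ^+ p.

(* The trace is computed in R; in GR(p^r, m) its values lie in the copy
   { c%:A } of Z_{p^r} inside R. *)
Definition gtrace (z : R) : R := \sum_(k < m) iter k gfrob z.

Definition trace_dual (b a : {ffun 'I_m -> R}) : Prop :=
  forall i j, gtrace (b i * a j) = (i == j)%:R.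

End Frobenius.

(* Main.v *)
From HB Require Import structures.
Require Import Defs.
From mathcomp Require Import all_boot all_order all_algebra.
From mathcomp Require Import all_fingroup all_solvable.
From mathcomp Require Import qpoly finfield qfpoly.

(* Let R = GR(p^r, m), q = p^m, and let pi : R -> K be the reduction mod p.
   Hensel's lemma gives a root of h congruent to X^p mod p, hence a ring
   endomorphism sigma of R lifting the Frobenius of K.  The Teichmuller set
   consists of the roots of X^q - X, one in each residue class; so sigma is
   t |-> t^p on it, i.e. sigma is the generalized Frobenius.  It satisfies
   sigma^m = id, and its fixed points are the multiples of 1 because their
   digits are; so the trace T is linear with values in Z_{p^r}.  Mod p the trace
   is a polynomial of degree p^(m-1) < q, so some trace is a unit; as every
   nonzero d is p^k times a unit, d = 0 as soon as T(z d) = 0 for all z.  Hence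
   d |-> (T(b_i d))_i is injective from R to (Z_{p^r})^m, and bijective since
   both sides have p^(r m) elements. *)

Set Implicit Arguments.
Unset Strict Implicit.
Unset Printing Implicit Defensive.

Import GRing.Theory.
Local Open Scope ring_scope.

(** * Second-order Taylor expansion and the prime subfield *)

Lemma horner_addr_quadratic (R : comNzRingType) (f : {poly R}) (x e : R) :
  exists c, f.[x + e] = f.[x] + e * (f^`().[x] + e * c).
Proof.
have hs : (size f <= (size f).+2)%N by apply: leq_trans (leqnSn _) (leqnSn _).
rewrite (nderiv_taylor_wide (mulrC x e) hs) !big_ord_recl.
(* [c] collects the terms of order at least two; divided derivatives make the formula valid over any
   commutative ring. *)
exists (\sum_(i < size f) f^`N(i.+2).[x] * e ^+ i).
rewrite nderivn0 nderivn1 expr0 expr1 mulr1 mulrDr [e * f^`().[x]]mulrC.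
congr (_ + (_ + _)); rewrite !mulr_sumr; apply: eq_bigr => i _.
by rewrite !exprS mulrCA; congr (_ * _); rewrite mulrCA.
Qed.

(** The numerals below [p] are [p] distinct roots of X^p - X, which has at most [p] roots. *)
Lemma prime_subfield_root (K : fieldType) (p : nat) (x : K) :
  p \in [pchar K] -> x ^+ p = x -> exists2 n, (n < p)%N & x = n%:R.
Proof.
move=> chK xp; have p_pr := pcharf_prime chK.
have p_gt1 := prime_gt1 p_pr.
pose rs : seq K := [seq n%:R | n <- iota 0 p].
have frob n : (n%:R : K) ^+ p = n%:R.
  by rewrite -(pFrobenius_autE chK) pFrobenius_aut_nat.
have rsU : uniq rs.
  rewrite map_inj_in_uniq ?iota_uniq // => i j; rewrite !mem_iota /= !add0n.
  wlog le_ij : i j / (i <= j)%N.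
    by move=> H; case: (leqP i j) => [|/ltnW] le hi hj e;
      [apply: H | symmetry; apply: H].
  move=> hi hj /esym/eqP; rewrite -subr_eq0 -natrB // -(dvdn_pcharf chK).
  move=> d; apply/eqP; rewrite eqn_leq le_ij /= -subn_eq0.
  apply/eqP; apply/eqP; case: posnP => // sub_gt0.
  have := dvdn_leq sub_gt0 d.
  by rewrite leqNgt (leq_ltn_trans (leq_subr _ _) hj).
have [/mapP[n] | x_rs] := boolP (x \in rs).
  by rewrite mem_iota => /= np ->; exists n.
have sz : size ('X^p - 'X : {poly K}) = p.+1.
  by rewrite size_polyDl size_polyXn // size_polyN size_polyX.
have nz : ('X^p - 'X : {poly K}) != 0 by rewrite -size_poly_gt0 sz.
have := @max_poly_roots _ _ (x :: rs) nz.
rewrite /= x_rs rsU sz size_map size_iota ltnS ltnn.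
move=> /(_ _ isT) H; suff : false by []. apply: H; apply/andP; split.
  by rewrite rootE !hornerE xp subrr.
by apply/allP => _ /mapP[n _ ->]; rewrite rootE !hornerE frob subrr.
Qed.

(** * Finite rings with a residue map modulo p: units and Hensel's lemma *)

Section TeichmullerFrobenius.

Variables (p r m : nat) (R : finComNzRingType) (K : finFieldType).
Variables (pi : {rmorphism R -> K}).
Hypotheses (p_prime : prime p) (r_gt0 : (0 < r)%N) (m_gt0 : (0 < m)%N).
Hypothesis pi_surj : forall x, exists z, pi z = x.
Hypothesis pi_ker : forall z, pi z = 0 -> exists y, z = p%:R * y.
Hypothesis p_nil : p%:R ^+ r = 0 :> R.
Hypothesis cardK : #|K| = (p ^ m)%N.
Hypothesis cardR : #|R| = ((p ^ m) ^ r)%N.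

Local Notation q := (p ^ m)%N.

Let chK : p \in [pchar K].
Proof. exact: (card_finPcharP cardK). Qed.

Let q_gt1 : (1 < q)%N.
Proof. by rewrite -cardK finNzRing_gt1. Qed.

Let q_prednK : q.-1.+1 = q.
Proof. by rewrite prednK // ltnW. Qed.

(** If [w] lifts the inverse of [pi u], then u w = 1 - p y with p y nilpotent, so a geometric series
    inverts u w. *)
Lemma residue_unit u : pi u != 0 -> exists v, u * v = 1.
Proof.
move=> nz_u; have [w pi_w] := pi_surj (pi u)^-1.
have [|y uw] := pi_ker (z := 1 - u * w).
  by rewrite rmorphB rmorphM pi_w rmorph1 divff // subrr.
exists (w * \sum_(i < r) (p%:R * y) ^+ i).
have -> : u * (w * \sum_(i < r) (p%:R * y) ^+ i)
    = (1 - (1 - u * w)) * \sum_(i < r) (p%:R * y) ^+ i.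
  by rewrite subKr mulrA.
by rewrite uw -[1 - _]opprB mulNr -subrX1 exprMn p_nil mul0r sub0r opprK.
Qed.

Lemma residue_lreg u x : pi u != 0 -> x * u = 0 -> x = 0.
Proof.
by move=> /residue_unit[v uv] xu; rewrite -[x]mulr1 -uv mulrA xu mul0r.
Qed.

(** In f(y) - f(x) = (y - x)(f'(x) + (y - x) c) the last factor has the same residue as f'(x), so it
    can be cancelled. *)
Lemma hensel_unique (f : {poly R}) (x y : R) :
  pi f^`().[x] != 0 -> pi x = pi y -> f.[x] = f.[y] -> x = y.
Proof.
move=> df pixy fxy; have [c] := horner_addr_quadratic f x (y - x).
rewrite [x + _]addrC subrK fxy -[LHS]addr0 => /addrI/esym/residue_lreg.
rewrite rmorphD rmorphM rmorphB pixy subrr mul0r addr0.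
by move=> /(_ df)/eqP; rewrite subr_eq0 => /eqP.
Qed.

(* By [hensel_unique], e |-> f.[x + e] permutes the finite kernel of pi, so it
   takes the value 0. *)
Lemma hensel_exists (f : {poly R}) (x : R) :
  pi f.[x] = 0 -> pi f^`().[x] != 0 -> exists2 y, f.[y] = 0 & pi y = pi x.
Proof.
move=> fx df; pose S := [set e : R | pi e == 0].
have pi_taylor (g : {poly R}) e : e \in S -> pi g.[x + e] = pi g.[x].
  rewrite inE => /eqP pi_e; have [c ->] := horner_addr_quadratic g x e.
  by rewrite rmorphD rmorphM pi_e mul0r addr0.
have g_inj : {in S &, injective (fun e => f.[x + e])}.
  move=> e1 e2 e1S e2S /= /hensel_unique H; apply: (@addrI _ x); apply: H.
    by rewrite pi_taylor.
  by move: e1S e2S; rewrite !inE !rmorphD => /eqP -> /eqP ->.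
have gS : [set f.[x + e] | e in S] = S.
  apply/eqP; rewrite eqEcard card_in_imset // leqnn andbT.
  by apply/subsetP=> _ /imsetP[e eS ->]; rewrite inE pi_taylor ?fx.
have : 0 \in S by rewrite inE rmorph0.
rewrite -gS => /imsetP[e eS fxe]; exists (x + e) => //.
by move: eS; rewrite inE rmorphD => /eqP ->; rewrite addr0.
Qed.

(** * Teichmuller representatives as roots of X^q - X *)

Let teich_poly : {poly R} := 'X^q - 'X.

Let teich_polyE x : teich_poly.[x] = x ^+ q - x.
Proof. by rewrite !hornerE. Qed.

(** The derivative q X^(q-1) - 1 reduces to -1, so Hensel's lemma applies at every point. *)
Let teich_poly_deriv x : pi teich_poly^`().[x] != 0.
Proof.
rewrite derivB derivXn derivX hornerD hornerMn hornerN hornerC.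
rewrite rmorphB rmorphMn rmorph1 -mulr_natr natrX (pcharf0 chK) expr0n.
rewrite gtn_eqF // mulr0 sub0r.
by rewrite oppr_eq0 oner_eq0.
Qed.

(** Through this, identities between Teichmuller elements are verified in [K]. *)
Lemma teich_inj x y : x ^+ q = x -> y ^+ q = y -> pi x = pi y -> x = y.
Proof.
move=> xq yq pixy; apply: (@hensel_unique teich_poly) => //.
by rewrite !teich_polyE xq yq !subrr.
Qed.

Lemma teich_lift (x : K) : exists2 t, t ^+ q = t & pi t = x.
Proof.
have [z <-] := pi_surj x.
have [||t] := @hensel_exists teich_poly z; last 1 first.
- by rewrite teich_polyE => /eqP; rewrite subr_eq0 => /eqP; exists t.
- by rewrite teich_polyE rmorphB rmorphXn -cardK expf_card subrr.
- exact: teich_poly_deriv.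
Qed.

(** A generator of the multiplicative group of [K] lifts to a root t of X^q - X. Then t^(q-1) = 1,
    and the order of t is a multiple of that of its image. *)
Lemma prim_root_exists : exists x : R, q.-1.-primitive_root x.
Proof.
have q1_gt0 : (0 < q.-1)%N by rewrite -ltnS q_prednK.
have := @has_prim_root K q.-1 (enum [pred x : K | x != 0]) q1_gt0.
rewrite enum_uniq -cardE -cardK cardC1 leqnn => /(_ _ isT isT).
case/(_ _)/hasP.
  apply/allP=> x; rewrite mem_enum inE => nz_x; rewrite unity_rootE.
  rewrite -(inj_eq (mulfI nz_x)) -exprS cardK q_prednK -cardK.
  by rewrite expf_card mulr1.
rewrite cardK => x _ x_prim; have [t tq pi_t] := teich_lift x; exists t.
have t1 : t ^+ q.-1 = 1.
  apply: teich_inj; rewrite ?expr1n //; first by rewrite exprAC tq.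
  by rewrite rmorphXn pi_t (prim_expr_order x_prim) rmorph1.
have [k k_prim /dvdnP[l Dl]] := prim_order_exists q1_gt0 t1.
suff -> : q.-1 = k by [].
apply/eqP; rewrite eqn_dvd {2}Dl dvdn_mull ?dvdnn // andbT.
rewrite (prim_order_dvd x_prim) -pi_t -rmorphXn (prim_expr_order k_prim).
by rewrite rmorph1.
Qed.

Local Notation xi := (teich_gen p m R).
Local Notation teich := (teich_set p m R).

Lemma teich_gen_prim : q.-1.-primitive_root xi.
Proof.
rewrite /teich_gen; case: pickP => [x //|no_root].
by have [x] := prim_root_exists; rewrite no_root.
Qed.

(** To place a root t in the set: [pi xi] still has order q - 1 by [teich_inj], so a nonzero [pi t]
    is a power of it, and [teich_inj] lifts this identity to [R]. *)
Lemma teich_setP t : reflect (t ^+ q = t) (t \in teich).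
Proof.
have xi1 := prim_expr_order teich_gen_prim.
have xiq : xi ^+ q = xi by rewrite -{1}q_prednK exprS xi1 mulr1.
apply: (iffP setU1P) => [[->|/imsetP[k _ ->]]|tq].
- by rewrite expr0n gtn_eqF // ltnW.
- by rewrite -exprM mulnC exprM xiq.
have [pi_t|nz_t] := eqVneq (pi t) 0.
  by left; apply: teich_inj; rewrite ?rmorph0 // expr0n gtn_eqF // ltnW.
right; have pi_prim : q.-1.-primitive_root (pi xi).
  have pi_xi1 : pi xi ^+ q.-1 = 1 by rewrite -rmorphXn xi1 rmorph1.
  have [|k k_prim kq] := prim_order_exists _ pi_xi1.
    by rewrite -ltnS q_prednK.
  suff -> : q.-1 = k by [].
  apply/eqP; rewrite eqn_dvd kq andbT (prim_order_dvd teich_gen_prim).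
  apply/eqP; apply: teich_inj; rewrite ?expr1n // -?exprM ?[(k * _)%N]mulnC.
    by rewrite exprM xiq.
  by rewrite rmorphXn (prim_expr_order k_prim) rmorph1.
have [|k pi_tE] := prim_rootP pi_prim (x := pi t).
  by apply: (mulfI nz_t); rewrite -exprS q_prednK -cardK expf_card mulr1.
apply/imsetP; exists k => //; apply: teich_inj => //.
  by rewrite -exprM mulnC exprM xiq.
by rewrite rmorphXn pi_tE.
Qed.

Lemma teich_expp t : t \in teich -> t ^+ p \in teich.
Proof. by move/teich_setP=> tq; apply/teich_setP; rewrite exprAC tq. Qed.

(** * Teichmuller digits *)

(** Digits are split off one at a time: the next one is the Teichmuller lift of the residue of the
    current cofactor [w], and the final remainder p^r w vanishes. *)
Lemma teich_expansion z :
  exists2 t : {ffun 'I_r -> R}, forall i, t i \in teich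
    & z = \sum_(i < r) p%:R ^+ i * t i.
Proof.
suff H n : exists t : {ffun 'I_n -> R}, exists w,
  (forall i, t i \in teich) /\ z = \sum_(i < n) p%:R ^+ i * t i + p%:R ^+ n * w.
  by have [t [w [tT zE]]] := H r; exists t; rewrite // zE p_nil mul0r addr0.
elim: n => [|n [t [w [tT ->]]]].
  by exists [ffun=> 0], z; split=> [[]//|]; rewrite big_ord0 add0r mul1r.
have [u uq pi_u] := teich_lift (pi w).
have [|v wv] := pi_ker (z := w - u); first by rewrite rmorphB pi_u subrr.
(* The new digit [u] goes to the last index. *)
exists [ffun i => if unlift ord_max i is Some j then t j else u], v; split.
  by move=> i; rewrite ffunE; case: unlift => [//|]; apply/teich_setP.
rewrite big_ord_recr /= ffunE unlift_none -addrA exprSr -mulrA -mulrDr -wv.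
rewrite [u + _]addrC subrK; congr (_ + _); apply: eq_bigr => i _.
rewrite ffunE (_ : widen_ord _ i = lift ord_max i) ?liftK //.
by apply: val_inj; rewrite /= /bump leqNgt ltn_ord.
Qed.

Lemma card_teich : #|teich| = q.
Proof.
rewrite -cardK; apply/eqP; rewrite eqn_leq; apply/andP; split.
  rewrite -(@card_in_imset _ _ pi); first exact: max_card.
  by move=> x y /teich_setP xq /teich_setP yq; apply: teich_inj.
rewrite -cardsT (_ : setT = pi @: teich) ?leq_imset_card //.
apply/esym/setP => x.
rewrite inE; have [t /teich_setP tT <-] := teich_lift x.
by apply/imsetP; exists t.
Qed.

(** By counting: the q^r digit sequences map onto the q^r elements of [R]. *)
Lemma teich_expansion_inj (s t : {ffun 'I_r -> R}) :
  (forall i, s i \in teich) -> (forall i, t i \in teich) ->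
  \sum_(i < r) p%:R ^+ i * s i = \sum_(i < r) p%:R ^+ i * t i -> s = t.
Proof.
pose D : {pred {ffun 'I_r -> R}} := ffun_on (mem teich).
pose g (s : {ffun 'I_r -> R}) := \sum_(i < r) p%:R ^+ i * s i.
have /image_injP g_inj : #|image g D| == #|D|.
  rewrite eqn_leq leq_image_card card_ffun_on card_teich card_ord -cardR.
  apply: subset_leq_card; apply/subsetP => z _; apply/imageP.
  have [u uT zE] := teich_expansion z; exists u => //.
  by rewrite -topredE; apply/ffun_onP.
by move=> sT tT; apply: g_inj; apply/ffun_onP.
Qed.

Lemma teich_digitsP z : [/\ forall i, teich_digits p r m z i \in teich
  & z = \sum_(i < r) p%:R ^+ i * teich_digits p r m z i].
Proof.
rewrite /teich_digits; case: pickP => [t /andP[/forallP tT /eqP]|no] //=.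
have [t tT zE] := teich_expansion z; have := no t.
by rewrite -zE eqxx andbT => /forallP[].
Qed.

(** The residue of [t] is that of an integer [n]. If p divides n then t = 0; otherwise [n] is
    replaced by a congruent integer that is itself a root of X^q - X in [R]. *)
Lemma teich_fixed_nat t : t \in teich -> t ^+ p = t -> exists n, t = n%:R.
Proof.
move=> tT tp; have [|n _ pi_t] := @prime_subfield_root K p (pi t) chK.
  by rewrite -rmorphXn tp.
have [p_n|] := boolP (p %| n)%N.
  exists 0; apply: teich_inj; [exact/teich_setP| |].
    by rewrite expr0n gtn_eqF // ltnW.
  by rewrite pi_t rmorph0; apply/eqP; rewrite -(dvdn_pcharf chK).
rewrite -prime_coprime // => co_pn.
have natr_mod k : (k %% p ^ r)%:R = k%:R :> R.
  by rewrite {2}(divn_eq k (p ^ r)) natrD natrM natrX p_nil mulr0 add0r.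
(* By Euler's theorem, n^(p^(r-1)) is a root of X^(p-1) - 1. *)
exists (n ^ p ^ r.-1)%N; set u := (n ^ _)%N.
have up1 : u%:R ^+ p.-1 = 1 :> R.
  rewrite -natrX -natr_mod -expnM mulnC -totient_pfactor //.
  by rewrite Euler_exp_totient ?natr_mod // coprime_sym coprimeXl.
have up : u%:R ^+ p = u%:R :> R.
  by rewrite -{1}(prednK (prime_gt0 p_prime)) exprS up1 mulr1.
(* Used with exponent p^m in [R], making [u] a Teichmuller element, and with p^(r-1) in [K], giving
   [u] and [n] the same residue. *)
have frobn k (S : comNzRingType) (x : S) : x ^+ p = x -> x ^+ (p ^ k)%N = x.
  by move=> xp; elim: k => [|k IH] //; rewrite expnS exprM xp.
apply: teich_inj; [exact/teich_setP | exact: frobn |].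
rewrite pi_t rmorph_nat /u natrX frobn //.
by rewrite -(pFrobenius_autE chK) pFrobenius_aut_nat.
Qed.

(** * A lift of Frobenius and its fixed points *)

Variable sigma : {rmorphism R -> R}.
Hypothesis pi_sigma : forall z, pi (sigma z) = pi z ^+ p.

(** Both sides are roots of X^q - X with the same residue. *)
Lemma sigma_teich t : t \in teich -> sigma t = t ^+ p.
Proof.
move=> tT; apply: teich_inj; last by rewrite pi_sigma rmorphXn.
  by rewrite -rmorphXn (teich_setP _ tT).
exact/teich_setP/teich_expp.
Qed.

(** The digitwise map thus inherits additivity and multiplicativity from [sigma]. *)
Lemma gfrobE z : gfrob p r m z = sigma z.
Proof.
have [tT {2}->] := teich_digitsP z; rewrite rmorph_sum; apply: eq_bigr => i _.
by rewrite rmorphM rmorphXn rmorph_nat sigma_teich.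
Qed.

Lemma iter_sigma_teich k t : t \in teich -> iter k sigma t = t ^+ (p ^ k)%N.
Proof.
move=> tT; elim: k => //= k ->.
by rewrite rmorphXn sigma_teich // -!exprM expnS.
Qed.

Lemma iter_sigmaB k : {morph iter k sigma : x y / x - y}.
Proof. by move=> x y; elim: k => //= k ->; rewrite rmorphB. Qed.

Lemma iter_sigmaM k : {morph iter k sigma : x y / x * y}.
Proof. by move=> x y; elim: k => //= k ->; rewrite rmorphM. Qed.

Lemma iter_sigma_nat k n : iter k sigma n%:R = n%:R.
Proof. by elim: k => //= k ->; rewrite rmorph_nat. Qed.

Lemma iter_sigma_sum k (F : 'I_r -> R) :
  iter k sigma (\sum_(i < r) F i) = \sum_(i < r) iter k sigma (F i).
Proof. by elim: k => //= k ->; rewrite rmorph_sum. Qed.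

Lemma iter_sigma_m z : iter m sigma z = z.
Proof.
have [tT zE] := teich_digitsP z; rewrite {1}zE {2}zE iter_sigma_sum.
apply: eq_bigr => i _; rewrite iter_sigmaM -natrX iter_sigma_nat.
by rewrite iter_sigma_teich // (teich_setP _ (tT i)).
Qed.

(** [sigma] raises the digits to the power p, so by their uniqueness the digits of a fixed point
    satisfy t^p = t and are integers. *)
Lemma sigma_fixed_nat z : sigma z = z -> exists n, z = n%:R.
Proof.
move=> fix_z; have [tT zE] := teich_digitsP z.
set t := teich_digits p r m z in tT zE.
have tp i : t i ^+ p = t i.
  have : [ffun i => t i ^+ p] = t.
    apply: teich_expansion_inj => // [j|]; first by rewrite ffunE teich_expp.
    rewrite -zE -[RHS]fix_z zE rmorph_sum; apply: eq_bigr => j _.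
    by rewrite ffunE rmorphM rmorphXn rmorph_nat sigma_teich.
  by move/ffunP/(_ i); rewrite ffunE.
have /fin_all_exists[n tn] i := teich_fixed_nat (tT i) (tp i).
exists (\sum_(i < r) p ^ i * n i)%N; rewrite natr_sum zE.
by apply: eq_bigr => i _; rewrite natrM natrX tn.
Qed.

(** * The trace and its nondegeneracy *)

Local Notation Tr := (@gtrace p r m R).

Lemma gtraceE z : Tr z = \sum_(k < m) iter k sigma z.
Proof.
by apply: eq_bigr => k _; elim: (k : nat) => //= j ->; rewrite gfrobE.
Qed.

Lemma gtraceB : {morph Tr : x y / x - y}.
Proof.
move=> x y; rewrite !gtraceE -sumrB; apply: eq_bigr => k _.
exact: iter_sigmaB.
Qed.

Lemma gtraceMn n z : Tr (n%:R * z) = n%:R * Tr z.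
Proof.
rewrite !gtraceE mulr_sumr; apply: eq_bigr => k _.
by rewrite iter_sigmaM iter_sigma_nat.
Qed.

Lemma gtrace_nat z : exists n, Tr z = n%:R.
Proof.
apply: sigma_fixed_nat; rewrite gtraceE rmorph_sum /=.
(* [sigma] shifts the summands cyclically: the last term on the left becomes sigma^m z, the first on
   the right is z. *)
rewrite -[in LHS](prednK m_gt0) -[in RHS](prednK m_gt0) big_ord_recr.
rewrite [in RHS]big_ord_recl addrC; congr (_ + _).
by apply: etrans (iter_sigma_m z); rewrite -[in RHS](prednK m_gt0).
Qed.

Lemma gtrace_unit : exists z, pi (Tr z) != 0.
Proof.
pose g : {poly K} := \sum_(k < m) 'X^(p ^ k).
have p_gt1 := prime_gt1 p_prime.
have szg : (size g <= (p ^ m.-1).+1)%N.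
  apply: leq_trans (size_sum _ _ _) _; apply/bigmax_leqP => k _.
  by rewrite size_polyXn ltnS leq_exp2l // -ltnS prednK.
(* The coefficient of X is 1, coming from k = 0 alone. *)
have nz_g : g != 0.
  apply/eqP => /(congr1 (fun f : {poly K} => f`_1))/eqP.
  rewrite coef0 coef_sum (bigD1 (Ordinal m_gt0)) //= coefXn eqxx big1 ?addr0.
    by rewrite oner_eq0.
  move=> k nz_k; rewrite coefXn -[1%N in X in X%:R](expn0 p) eqn_exp2l //.
  by case: eqP => // k0; case/eqP: nz_k; apply: val_inj.
have [x gx] : exists x, ~~ root g x.
  apply/existsP; rewrite -negb_forall; apply/negP => /forallP all_root.
  have /allP/(max_poly_roots nz_g) : {in enum K, forall x, root g x} by [].
  rewrite enum_uniq -cardE cardK => /(_ isT); rewrite ltnNge => /negP; apply.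
  by apply: leq_trans szg _; rewrite ltn_exp2l // prednK.
have [z pi_z] := pi_surj x; exists z; rewrite gtraceE rmorph_sum.
move: gx; rewrite rootE horner_sum; congr (_ != _).
apply: eq_bigr => k _; rewrite hornerXn -pi_z.
by elim: (k : nat) => //= j IH; rewrite pi_sigma -IH -exprM expnSr.
Qed.

(** Factors p are extracted while the residue is zero; as p^r = 0 and [d] is nonzero, this stops
    within r steps. *)
Lemma p_power_factor (d : R) :
  d != 0 -> exists k u, d = p%:R ^+ k * u /\ pi u != 0.
Proof.
move=> nz_d; suff H k : (exists j u, d = p%:R ^+ j * u /\ pi u != 0)
    \/ exists u, d = p%:R ^+ k * u.
  by have [//|[u dE]] := H r; move: nz_d; rewrite dE p_nil mul0r eqxx.
elim: k => [|k [H|[u dE]]]; [by right; exists d; rewrite mul1r|by left|].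
have [/pi_ker[v uE]|nz_u] := eqVneq (pi u) 0; last by left; exists k, u.
by right; exists v; rewrite dE uE exprSr mulrA.
Qed.

(** For a nonzero d = p^k u take z = w v with v inverse to u and Tr(w) a unit: Tr(z d) = p^k Tr(w) =
    0 forces p^k = 0. *)
Lemma gtrace_nondegenerate d : (forall z, Tr (z * d) = 0) -> d = 0.
Proof.
move=> Td; apply/eqP; apply/negP => /negP nz_d.
have [k [u [dE nz_u]]] := p_power_factor nz_d.
have [v uv] := residue_unit nz_u; have [w Tw] := gtrace_unit.
have : p%:R ^+ k * Tr w = 0.
  rewrite -natrX -gtraceMn natrX -(Td (w * v)); congr (Tr _).
  by rewrite dE -mulrA [v * _]mulrCA [v * u]mulrC uv mulr1 mulrC.
move/(residue_lreg Tw) => pk0; move: nz_d; by rewrite dE pk0 mul0r eqxx.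
Qed.

End TeichmullerFrobenius.

(** * Morphisms out of polynomial quotient rings *)

(** Universal property of the quotient: [g] is applied to the reduced representative, which differs
    from [u] by a multiple of the modulus. *)
Lemma qpoly_rmorphism (A S : comNzRingType) (h : {poly A})
    (g : {rmorphism {poly A} -> S}) :
  g (mk_monic h) = 0 ->
  {f : {rmorphism {poly %/ h} -> S} | forall u, f (in_qpoly h u) = g u}.
Proof.
move=> gh; have hM := monic_mk_monic h.
pose f (z : {poly %/ h}) : S := g z.
have fE u : f (in_qpoly h u) = g u.
  rewrite {2}(Pdiv.RingMonic.rdivp_eq hM u).
  by rewrite rmorphD rmorphM gh mulr0 add0r.
have fB : zmod_morphism f by move=> x y; rewrite /f -rmorphB.
have fM : monoid_morphism f.
  by split=> [|x y]; [rewrite /f rmorph1 | rewrite [LHS]fE rmorphM].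
pose fR : {rmorphism {poly %/ h} -> S} :=
  HB.pack f (GRing.isZmodMorphism.Build _ _ f fB)
    (GRing.isMonoidMorphism.Build _ _ f fM).
by exists fR.
Qed.

Lemma qpoly_horner (A : comNzRingType) (h : {poly A}) (u : {poly A}) :
  in_qpoly h u = (map_poly (qpolyC h) u).['qX].
Proof. by rewrite -{1}[u]comp_polyXr in_qpoly_comp_horner. Qed.

Lemma in_qpolyK (A : nzRingType) (h : {poly A}) (z : {poly %/ h}) :
  in_qpoly h z = z.
Proof. by apply: val_inj; apply: in_qpoly_small; apply: size_mk_monic. Qed.

Lemma size_qpoly (A : nzRingType) (h : {poly A}) (z : {poly %/ h}) :
  mk_monic h = h -> (size (z : {poly A}) < size h)%N.
Proof. by move=> hE; rewrite -{2}hE size_mk_monic. Qed.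

(** * The Galois ring and its residue field *)

Section GaloisRing.

Variables (p r m : nat).
Hypotheses (p_prime : prime p) (r_gt0 : (0 < r)%N) (m_gt0 : (0 < m)%N).

Local Notation A := 'Z_(p ^ r).

Let pr_gt1 : (1 < p ^ r)%N.
Proof. by rewrite -{1}(expn0 p) ltn_exp2l // prime_gt1. Qed.

(** A morphism because p divides p^r. It is given in [Type] so that [sval] can serve as a
    definition. *)
Lemma red_rmorphism :
  {red : {rmorphism A -> 'F_p} | forall c : A, red c = (c : nat)%:R}.
Proof.
pose f (c : A) : 'F_p := (c : nat)%:R.
have f_nat n : f n%:R = n%:R.
  rewrite /f val_Zp_nat // -[LHS](Fp_nat_mod p_prime) modn_dvdm ?Fp_nat_mod //.
  exact: dvdn_exp.
have fM : monoid_morphism f.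
  split=> [|x y]; first exact: (f_nat 1).
  by rewrite -[x in x * _]natr_Zp -[y in _ * y]natr_Zp -natrM f_nat natrM.
have fN : nmod_morphism f.
  split=> [|x y]; first exact: (f_nat 0).
  by rewrite -[x in x + _]natr_Zp -[y in _ + y]natr_Zp -natrD f_nat natrD.
pose fR : {rmorphism A -> 'F_p} :=
  HB.pack f (GRing.isNmodMorphism.Build _ _ f fN)
    (GRing.isMonoidMorphism.Build _ _ f fM).
by exists fR.
Qed.

(** Elements are polynomials in ['qX] whose coefficients are numerals, on which all ring morphisms
    agree. *)
Lemma qpoly_rmorph_eq (h : {poly A}) (S : comNzRingType)
    (f g : {rmorphism {poly %/ h} -> S}) :
  f 'qX = g 'qX -> f =1 g.
Proof.
move=> fgX z; rewrite -(in_qpolyK z) qpoly_horner -!horner_map fgX.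
rewrite -!map_poly_comp; congr (_.[_]); apply: eq_map_poly => c /=.
by rewrite -(natr_Zp c) !rmorph_nat.
Qed.

Variable h : {poly A}.
Hypothesis h_galois : galois_poly p r m h.

Let h_monic : h \is monic. Proof. by case: h_galois. Qed.
Let h_size : size h = m.+1. Proof. by case: h_galois. Qed.

Let mk_monic_h : mk_monic h = h.
Proof. by rewrite /mk_monic h_size ltnS m_gt0 h_monic. Qed.

Local Notation R := {poly %/ h}.

Let red : {rmorphism A -> 'F_p} := sval red_rmorphism.
Let redE c : red c = (c : nat)%:R. Proof. exact: (svalP red_rmorphism). Qed.

Local Notation hb := (map_poly red h).

Let hb_monic : hb \is monic. Proof. exact: monic_map. Qed.
Let hb_irr : irreducible_poly hb.
Proof.
case: h_galois => _ _; congr irreducible_poly.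
by apply: eq_map_poly => c; rewrite redE.
Qed.
Let hbI : monic_irreducible_poly hb := (hb_irr, hb_monic).

Local Notation K := {poly %/ hb with hbI}.

Let hb_size : size hb = m.+1.
Proof. by rewrite size_map_poly_id0 // (monicP h_monic) rmorph1 oner_eq0. Qed.

Lemma card_residue : #|K| = (p ^ m)%N.
Proof. by rewrite card_qfpoly hb_size card_Fp. Qed.

Lemma card_galois_ring : #|{poly %/ h}| = ((p ^ r) ^ m)%N.
Proof. by rewrite card_monic_qpoly ?h_size // card_ord Zp_cast. Qed.

Lemma residue_in_qpolyE u v : in_qpoly hb (u * hb + v) = in_qpoly hb v.
Proof.
apply: val_inj; rewrite /= (mk_monicE hbI).
by rewrite Pdiv.RingMonic.rmodpD // Pdiv.RingMonic.rmodp_mull // add0r.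
Qed.

Lemma residue_modulus : in_qpoly hb hb = 0.
Proof. by have := residue_in_qpolyE 1 0; rewrite mul1r addr0 rmorph0. Qed.

Lemma residue_exists : { pi : {rmorphism R -> K} |
  forall u, pi (in_qpoly h u) = in_qpoly hb (map_poly red u)}.
Proof.
pose g : {rmorphism {poly A} -> {poly %/ hb}} := in_qpoly hb \o map_poly red.
have [|pi piE] := @qpoly_rmorphism A {poly %/ hb} h g.
  by rewrite mk_monic_h /= residue_modulus.
by exists pi => u; rewrite piE.
Qed.

Let pi : {rmorphism R -> K} := sval residue_exists.
Let piE u : pi (in_qpoly h u) = in_qpoly hb (map_poly red u).
Proof. exact: (svalP residue_exists). Qed.

Lemma residue_surj x : exists z, pi z = x.
Proof.
pose u : {poly A} := \poly_(i < m) (val (x : {poly 'F_p})`_i)%:R.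
exists (in_qpoly h u); rewrite piE -[RHS](in_qpolyK (h := hb)).
congr in_qpoly; apply/polyP => i; rewrite coef_map coef_poly.
case: ltnP => [_|le_mi]; first by rewrite /= rmorph_nat natr_Zp.
rewrite /= raddf0 nth_default //; apply: leq_trans le_mi.
by have := size_qpoly x (mk_monicE hbI); rewrite hb_size.
Qed.

(** As [hb] has the degree of [h], the representative of [z] stays reduced mod p; so p divides each
    of its coefficients. *)
Lemma residue_ker z : pi z = 0 -> exists y, z = p%:R * y.
Proof.
rewrite -{1}(in_qpolyK z) piE => /(congr1 val) /=.
rewrite (mk_monicE hbI) Pdiv.CommonRing.rmodp_small; last first.
  rewrite (leq_ltn_trans (size_poly _ _)) // hb_size -h_size.
  exact: size_qpoly.
move=> z0; have p_dvd i : (p %| val ((z : {poly A})`_i)%R)%N.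
  have /(congr1 (fun f : {poly 'F_p} => f`_i)) := z0.
  rewrite coef_map coef0 /= redE => /eqP.
  by rewrite -(dvdn_pcharf (pchar_Fp p_prime)).
pose u : {poly A} := \poly_(i < size (z : {poly A}))
  (val ((z : {poly A})`_i)%R %/ p)%:R.
exists (in_qpoly h u).
rewrite -{1}(in_qpolyK z) -[p%:R in RHS](rmorph_nat (in_qpoly h)) -rmorphM.
congr in_qpoly; apply/polyP => i.
rewrite mulr_natl coefMn coef_poly; case: ltnP => [_|le_zi]; last first.
  by rewrite nth_default // mul0rn.
by rewrite -mulrnA divnK // natr_Zp.
Qed.

Lemma prime_nilpotent : p%:R ^+ r = 0 :> R.
Proof.
rewrite -natrX -(rmorph_nat (qpolyC h)) (_ : _%:R = 0) ?rmorph0 //.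
exact: pchar_Zp.
Qed.

Let chK : p \in [pchar K].
Proof. exact: (card_finPcharP card_residue). Qed.

(** Provides the simple-root condition for lifting Frobenius by Hensel's lemma. *)
Lemma residue_separable : in_qpoly hb hb^`() != 0 :> K.
Proof.
have : in_qpoly hb ('X^(p ^ m) - 'X) = 0 :> K.
  rewrite rmorphB rmorphXn -card_residue.
  by rewrite [X in X - _](expf_card (in_qpoly hb 'X : K)) subrr.
move/(congr1 val) => /=; rewrite (mk_monicE hbI) => rem0.
(* Differentiating X^q - X = s * hb at the root of hb gives -1 = s * hb'. *)
have := Pdiv.RingMonic.rdivp_eq hb_monic ('X^(p ^ m) - 'X).
rewrite rem0 addr0; set s := Pdiv.CommonRing.rdivp _ _.
move/(congr1 (fun f => in_qpoly hb f^`())).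
rewrite derivB derivXn derivX derivM -mulr_natr natrX.
have -> : p%:R = 0 :> {poly 'F_p} by rewrite -polyC_natr pchar_Fp_0.
rewrite expr0n gtn_eqF // mulr0 sub0r residue_in_qpolyE rmorphM rmorphN rmorph1.
move=> e; apply/eqP => hb0; move: e; rewrite [X in _ * X]hb0 mulr0 => /eqP.
by rewrite oppr_eq0 oner_eq0.
Qed.

(** * Lifting the Frobenius *)

Let frob : {rmorphism K -> K} := pFrobenius_aut chK.

(** Frobenius fixes the images of the coefficients, which are numerals, and moves only the point of
    evaluation. *)
Lemma pi_horner_Frobenius (u : {poly A}) :
  pi (map_poly (qpolyC h) u).['qX ^+ p] = frob (pi (in_qpoly h u)).
Proof.
rewrite qpoly_horner -!horner_map rmorphXn -pFrobenius_autE -!map_poly_comp.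
congr (_.[_]); apply: eq_map_poly => c /=.
by rewrite -(natr_Zp c) !rmorph_nat.
Qed.

Lemma sigma_exists :
  {sigma : {rmorphism R -> R} | forall z, pi (sigma z) = pi z ^+ p}.
Proof.
(* The conditions are boolean so that [sigW] can extract the root into [Type]. *)
have : exists y : R,
    ((map_poly (qpolyC h) h).[y] == 0) && (pi y == pi 'qX ^+ p).
  have [|| y hy pi_y] := hensel_exists residue_surj residue_ker prime_nilpotent
    (f := map_poly (qpolyC h) h) (x := 'qX ^+ p).
  - rewrite pi_horner_Frobenius piE.
    by rewrite residue_modulus rmorph0.
  - rewrite deriv_map pi_horner_Frobenius piE fmorph_eq0 -deriv_map.
    exact: residue_separable.
  by exists y; rewrite hy pi_y rmorphXn !eqxx.
case/sigW => y /andP[/eqP hy /eqP pi_y].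
pose g : {rmorphism {poly A} -> R} := horner_eval y \o map_poly (qpolyC h).
have [|sigma sigmaE] := @qpoly_rmorphism A R h g; first by rewrite mk_monic_h.
exists sigma => z; rewrite -pFrobenius_autE.
(* Two morphisms, to be compared at ['qX] only. *)
pose f1 : {rmorphism R -> K} := pi \o sigma.
pose f2 : {rmorphism R -> K} := frob \o pi.
apply: (@qpoly_rmorph_eq h K f1 f2) => /=.
by rewrite sigmaE /= map_polyX /horner_eval hornerX pi_y pFrobenius_autE.
Qed.

Local Notation Tr := (@gtrace p r m R).

Lemma galois_gtrace :
  [/\ {morph Tr : x y / x - y}, forall n z, Tr (n%:R * z) = n%:R * Tr z,
      forall z, exists n, Tr z = n%:R
    & forall d, (forall z, Tr (z * d) = 0) -> d = 0].
Proof.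
have [sigma pi_sigma] := sigma_exists.
have cR : #|R| = ((p ^ m) ^ r)%N by rewrite card_galois_ring -!expnM mulnC.
split.
- exact: (gtraceB p_prime m_gt0 residue_surj residue_ker prime_nilpotent
    card_residue pi_sigma).
- exact: (gtraceMn p_prime m_gt0 residue_surj residue_ker prime_nilpotent
    card_residue pi_sigma).
- exact: (gtrace_nat p_prime r_gt0 m_gt0 residue_surj residue_ker
    prime_nilpotent card_residue cR pi_sigma).
exact: (gtrace_nondegenerate p_prime m_gt0 residue_surj residue_ker
  prime_nilpotent card_residue pi_sigma).
Qed.

End GaloisRing.

(** * Existence and uniqueness of the dual basis *)

Theorem theorem3p7 (p r m : nat) (p_prime : prime p)
    (r_gt0 : (0 < r)%N) (m_gt0 : (0 < m)%N)
    (h : {poly 'Z_(p ^ r)}) (h_galois : galois_poly p r m h)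
    (b : {ffun 'I_m -> {poly %/ h}}) (b_basis : is_basis b) :
  exists! a : {ffun 'I_m -> {poly %/ h}},
    is_basis a /\ trace_dual p r b a.
Proof.
have [TrB TrMn Tr_nat Tr_nd] := galois_gtrace p_prime r_gt0 m_gt0 h_galois.
set Tr := @gtrace p r m _ in TrB TrMn Tr_nat Tr_nd *.
have cardR : #|{poly %/ h}| = (#|'Z_(p ^ r)| ^ m)%N.
  rewrite (card_galois_ring p_prime r_gt0 m_gt0 h_galois).
  rewrite [in RHS]card_ord Zp_cast //.
  by rewrite -[1%N](expn0 p) ltn_exp2l // prime_gt1.
have Tr0 : Tr 0 = 0 by have := TrB 0 0; rewrite !subrr.
have TrD : {morph Tr : x y / x + y}.
  by move=> x y; rewrite -{1}[y]opprK -[- y]sub0r !TrB Tr0 sub0r opprK.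
have TrZ (c : 'Z_(p ^ r)) z : Tr (c *: z) = c *: Tr z.
  by rewrite -(natr_Zp c) !scaler_nat -mulr_natl TrMn mulr_natl.
have Tr_sum (F : 'I_m -> {poly %/ h}) : Tr (\sum_i F i) = \sum_i Tr (F i).
  exact: (big_morph Tr TrD Tr0).
have [_ b_span] := b_basis.
(* As [b] spans, nondegeneracy can be tested on [b]. *)
have Tr_b_inj d d' : (forall i, Tr (b i * d) = Tr (b i * d')) -> d = d'.
  move=> Tdd'; apply/eqP; rewrite -subr_eq0; apply/eqP; apply: Tr_nd => z.
  have [c ->] := b_span z; rewrite mulr_suml Tr_sum big1 // => i _.
  by rewrite -scalerAl TrZ mulrBr TrB Tdd' subrr scaler0.
pose scalars : {set {poly %/ h}} := [set c%:A | c : 'Z_(p ^ r)].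
pose Phi d : {ffun 'I_m -> {poly %/ h}} := [ffun i => Tr (b i * d)].
have Phi_inj : injective Phi.
  move=> d d' /ffunP Edd'; apply: Tr_b_inj => i.
  by have := Edd' i; rewrite !ffunE.
(* At most (p^r)^m functions take values in [scalars], and the injective [Phi] already attains that
   many. *)
have Phi_onto : [set Phi d | d in setT] = [set g | g \in ffun_on (mem scalars)].
  apply/eqP; rewrite eqEcard card_imset // cardsT cardR; apply/andP; split.
    apply/subsetP => _ /imsetP[d _ ->]; rewrite inE; apply/ffun_onP => i.
    rewrite ffunE; have [n ->] := Tr_nat (b i * d).
    by apply/imsetP; exists n%:R; rewrite // scaler_nat.
  by rewrite cardsE card_ffun_on [#|'I_m|]card_ord leq_exp2r // leq_imset_card.
(* The j-th dual vector is the preimage under [Phi] of the j-th unit vector. *)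
have /fin_all_exists[a0 a0P] j :
    exists aj, forall i, Tr (b i * aj) = (i == j)%:R.
  have : [ffun i => (i == j)%:R] \in [set Phi d | d in setT].
    rewrite Phi_onto inE; apply/ffun_onP => i; rewrite ffunE.
    by apply/imsetP; exists (i == j)%:R; rewrite // scaler_nat.
  case/imsetP=> aj _ /ffunP Eaj; exists aj => i.
  by have := Eaj i; rewrite !ffunE.
pose a : {ffun 'I_m -> {poly %/ h}} := finfun a0.
have a_dual : trace_dual p r b a by move=> i j; rewrite ffunE; apply: a0P.
(* Pairing with [b i] reads off the i-th coefficient, whence the freeness of [a]. *)
have a_coord (c : {ffun 'I_m -> 'Z_(p ^ r)}) i :
    Tr (b i * \sum_j c j *: a j) = (c i)%:A.
  rewrite mulr_sumr Tr_sum (bigD1 i) //= big1 => [|j ne_ji].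
    by rewrite -scalerAr TrZ [Tr _]a_dual eqxx addr0.
  by rewrite -scalerAr TrZ [Tr _]a_dual eq_sym (negPf ne_ji) scaler0.
have alg_inj (c d : 'Z_(p ^ r)) : c%:A = d%:A :> {poly %/ h} -> c = d.
  move=> /(congr1 val)/= /(congr1 (fun f : {poly _} => f`_0)).
  by rewrite !coefZ coef1 !mulr1.
have comb_inj : injective
    (fun c : {ffun 'I_m -> 'Z_(p ^ r)} => \sum_j c j *: a j).
  move=> c d /= Ecd; apply/ffunP => i; apply: alg_inj.
  by rewrite -!a_coord Ecd.
exists a; split; last first.
  move=> a' [_ a'_dual]; apply/ffunP => j; apply: Tr_b_inj => i.
  by rewrite [LHS]a_dual [RHS]a'_dual.
split=> //; split=> [c c0|z].
  by apply: comb_inj; rewrite c0 big1 // => j _; rewrite ffunE scale0r.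
(* Spanning by counting: coefficient families and ring elements are equally many, so [comb_inj]
   gives surjectivity. *)
have /(inj_card_onto comb_inj)/(_ z)/codomP[c zE] :
    (#|{poly %/ h}| <= #|{ffun 'I_m -> 'Z_(p ^ r)}|)%N.
  by rewrite (leq_trans (eq_leq cardR)) // card_ffun [#|'I_m|]card_ord.
by exists c.
Qed.
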